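(* There is a constant $p_0$ such that for all primes $p>p_0$ with $p\equiv 1\pmod 4$, the statement $B(1.62,p)$ is false.
   Context: For an odd prime $p$ and a non-empty subset $S\subseteq GF(p)$ let $f_S(x)=\prod_{a\in S}(x-a)\in GF(p)[x]$, and let $X_S$ be the hyperelliptic curve $y^2=f_S(x)$. $|X_S(GF(p))|$ denotes the number of solutions $(x,y)\in GF(p)^2$ of $y^2=f_S(x)$ plus the number of points at infinity, which is $2$ if $|S|$ is even and $1$ if $|S|$ is odd. For a real number $c$, $B(c,p)$ is the statement: for all non-empty subsets $S\subseteq GF(p)$, $|X_S(GF(p))|\le c\cdot p$. *)

(* Defs.v *)
(* MathComp world; the real numbers are an arbitrary [R : realType]. *)
From mathcomp Require Import all_boot all_order all_algebra.
From mathcomp Require Import reals.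

Set Implicit Arguments.
Unset Strict Implicit.
Unset Printing Implicit Defensive.

Import Order.TTheory GRing.Theory Num.Theory.
Local Open Scope ring_scope.

(* ['F_p] is GF(p) only when [p] is prime; the definitions below are meant to
   be used for an odd prime [p]. *)

Definition fS (p : nat) (S : {set 'F_p}) : {poly 'F_p} :=
  \prod_(a in S) ('X - a%:P).

Definition affine_points (p : nat) (S : {set 'F_p}) : {set 'F_p * 'F_p} :=
  [set xy | xy.2 ^+ 2 == (fS S).[xy.1]].

Definition points_at_infinity (p : nat) (S : {set 'F_p}) : nat :=
  if odd #|S| then 1%N else 2%N.

(* |X_S(GF(p))| *)
Definition XS_points (p : nat) (S : {set 'F_p}) : nat :=
  (#|affine_points S| + points_at_infinity S)%N.

Definition B (R : realType) (c : R) (p : nat) : Prop :=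
  forall S : {set 'F_p}, S != set0 -> (XS_points S)%:R <= c * p%:R.

(* Main.v *)
(* Up to the points at infinity, [|X_S| - p] is the sum of chi (f_S x) over x,
   and twice this sum is the eigenvalue at the character [S] of the Cayley graph
   on the subsets of GF(p) with 2p generators, two for each x, one sign vector
   being [a |-> chi (x - a)] with value 1 at [a = x] and the other with -1.  If
   all these eigenvalues but the trivial one were at most 0.62 * 2p, the linear
   programming bound of McEliece, Rodemich, Rumsey and Welch, in the form of
   Navon and Samorodnitsky (test functions supported on a Hamming ball whose
   largest hypercube eigenvalue exceeds 0.62 * 2p), would force 2 ^ p to be at
   most a constant times the size of a Hamming ball of radius 5p/23 in dimension
   2p, which is exponentially smaller. *)
Require Import Defs.
From mathcomp Require Import all_boot all_order all_algebra.
From mathcomp Require Import all_fingroup all_solvable.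
From mathcomp Require Import reals ring lra zify.

Set Implicit Arguments.
Unset Strict Implicit.
Unset Printing Implicit Defensive.

Import Order.TTheory GRing.Theory Num.Theory.
Local Open Scope ring_scope.

(** * Linear programming bound for Cayley graphs on sign vectors *)

Lemma prodr_add1_distr (R : comPzRingType) (T : finType) (f : T -> R) :
  \prod_a (1 + f a) = \sum_(S : {set T}) \prod_(a in S) f a.
Proof.
under eq_bigr do rewrite addrC.
rewrite bigA_distr; apply: eq_big => // S _.
by rewrite [RHS]big_mkcond.
Qed.

Section LinearProgrammingBound.
Variables (R : realFieldType) (T J : finType) (g : J -> T -> R).
Hypothesis g_sqr : forall j a, g j a ^+ 2 = 1.

(** The value of the character [S] at the product of the sign vectors [g j] with [j] in [Y]: it
    pulls the character back to the hypercube of subsets of [J]. *)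
Definition charval (S : {set T}) (Y : {set J}) : R :=
  \prod_(j in Y) \prod_(a in S) g j a.

Definition charsum (S : {set T}) : R := \sum_j \prod_(a in S) g j a.

Definition flip (j : J) (Y : {set J}) : {set J} :=
  if j \in Y then Y :\ j else j |: Y.

Lemma flipK j : involutive (flip j).
Proof.
move=> Y; rewrite /flip; case: (boolP (j \in Y)) => jY.
  by rewrite !inE eqxx /= setD1K.
by rewrite !inE eqxx /= setU1K.
Qed.

Lemma charval_flip (S : {set T}) j Y :
  (\prod_(a in S) g j a) * charval S Y = charval S (flip j Y).
Proof.
have sq : (\prod_(a in S) g j a) * (\prod_(a in S) g j a) = 1.
  by rewrite -big_split big1 //= => a _; rewrite -expr2.
rewrite /charval /flip; case: (boolP (j \in Y)) => jY.
  by rewrite (big_setD1 j jY) /= mulrA sq mul1r.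
by rewrite big_setU1.
Qed.

Lemma sum_flip_card (phi : nat -> R) (Y : {set J}) :
  \sum_j phi #|flip j Y| =
  #|Y|%:R * phi #|Y|.-1 + (#|J|%:R - #|Y|%:R) * phi #|Y|.+1.
Proof.
rewrite (bigID (mem Y)) /=; congr (_ + _).
  rewrite (eq_bigr (fun=> phi #|Y|.-1)) ?sumr_const ?mulr_natl // => j jY.
  by rewrite /flip jY [#|Y|](cardsD1 j) jY.
rewrite (eq_bigr (fun=> phi #|Y|.+1)) => [|j jY]; last first.
  by rewrite /flip (negPf jY) cardsU1 jY.
rewrite (eq_bigl (fun j => j \in ~: Y)) => [|j]; last by rewrite !inE.
rewrite sumr_const -[LHS]mulr_natl; congr (_ * _).
by rewrite -(cardsC Y) natrD addrAC subrr add0r.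
Qed.

Definition radial (phi : nat -> R) (S : {set T}) : R :=
  \sum_(Y : {set J}) phi #|Y| * charval S Y.

(** Multiplication by the sign vector [j] moves [Y] to its neighbour [flip j Y], so the eigenvalue
    [charsum S] acts on [phi] as the adjacency operator of the hypercube. At [w = 0] the value
    [w.-1 = 0] is harmless: its weight is 0. *)
Lemma charsum_radial phi S :
  charsum S * radial phi S =
  radial (fun w => w%:R * phi w.-1 + (#|J|%:R - w%:R) * phi w.+1) S.
Proof.
rewrite /charsum mulr_suml.
transitivity (\sum_j \sum_(Y : {set J}) phi #|flip j Y| * charval S Y).
  apply: eq_bigr => j _; rewrite /radial mulr_sumr.
  rewrite (reindex_inj (inv_inj (flipK j))) /=; apply: eq_bigr => Y _.
  by rewrite mulrCA charval_flip flipK.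
rewrite exchange_big; apply: eq_bigr => Y _.
by rewrite -mulr_suml sum_flip_card.
Qed.

Lemma charval_sqr (S : {set T}) Y : charval S Y * charval S Y = 1.
Proof.
rewrite -big_split big1 //= => j _; rewrite -big_split big1 //= => a _.
by rewrite -expr2.
Qed.

(** The sum over [S] factors as a product over [a] of [1 + f a] with [f a] equal to 1 or -1, so
    every factor is 0 or 2. *)
Lemma sum_charval_ge0 Y Z : 0 <= \sum_(S : {set T}) charval S Y * charval S Z.
Proof.
pose f a := (\prod_(j in Y) g j a) * (\prod_(j in Z) g j a).
rewrite (eq_bigr (fun S : {set T} => \prod_(a in S) f a)) => [|S _]; last first.
  by rewrite /charval exchange_big /= [X in _ * X]exchange_big -big_split.
rewrite -prodr_add1_distr; apply: prodr_ge0 => a _.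
have: f a ^+ 2 = 1.
  rewrite exprMn -!prodrXl !big1 ?mulr1 // => j _; exact: g_sqr.
by move/eqP; rewrite sqrf_eq1 => /orP[] /eqP ->; rewrite ?subrr ?addr_ge0.
Qed.

(* Expand [\sum_S (charsum S - mu) * radial phi S ^+ 2] in two ways: only
   [S = set0] contributes positively, while on the other side all the character
   correlations are nonnegative and the diagonal ones equal [2 ^+ #|T|]. *)
Lemma linear_programming_bound (phi : nat -> R) (mu eps : R) :
    0 <= eps -> (forall w, 0 <= phi w) ->
    (forall w, (w <= #|J|)%N ->
      (mu + eps) * phi w <=
        w%:R * phi w.-1 + (#|J|%:R - w%:R) * phi w.+1) ->
    (forall S : {set T}, S != set0 -> charsum S <= mu) ->
  eps * 2 ^+ #|T| * (\sum_(Y : {set J}) phi #|Y| ^+ 2) <=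
    (#|J|%:R - mu) * (\sum_(Y : {set J}) phi #|Y|) ^+ 2.
Proof.
move=> eps0 phi0 sub le_mu.
pose L := \sum_(S : {set T}) (charsum S - mu) * radial phi S ^+ 2.
have up : L <= (#|J|%:R - mu) * (\sum_(Y : {set J}) phi #|Y|) ^+ 2.
  rewrite /L (bigD1 set0) //= -[leRHS]addr0 lerD //; last first.
    by apply: sumr_le0 => S S0; rewrite mulr_le0_ge0 ?sqr_ge0 // subr_le0 le_mu.
  have E Y : charval set0 Y = 1 by apply: big1 => j _; rewrite big_set0.
  have -> : charsum set0 = #|J|%:R.
    rewrite /charsum (eq_bigr (fun=> 1)) ?sumr_const // => j _.
    by rewrite big_set0.
  have -> // : radial phi set0 = \sum_(Y : {set J}) phi #|Y|.
  by apply: eq_bigr => Y _; rewrite E mulr1.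
apply: le_trans up.
(* [psi] is the hypercube adjacency operator minus [mu], applied to [phi]; on levels up to [#|J|] it
   is at least [eps * phi]. *)
pose psi w := w%:R * phi w.-1 + (#|J|%:R - w%:R) * phi w.+1 - mu * phi w.
have -> : L = \sum_(Y : {set J}) \sum_(Z : {set J})
    psi #|Y| * phi #|Z| * \sum_S charval S Y * charval S Z.
  transitivity (\sum_(S : {set T}) radial psi S * radial phi S).
    apply: eq_bigr => S _; rewrite expr2 mulrA mulrBl charsum_radial.
    congr (_ * _); rewrite /radial mulr_sumr -sumrB; apply: eq_bigr => Y _.
    by rewrite /psi [RHS]mulrBl mulrA.
  transitivity (\sum_(S : {set T}) \sum_(Y : {set J}) \sum_(Z : {set J})
      psi #|Y| * phi #|Z| * (charval S Y * charval S Z)).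
    apply: eq_bigr => S _; rewrite /radial mulr_suml; apply: eq_bigr => Y _.
    by rewrite mulr_sumr; apply: eq_bigr => Z _; rewrite mulrACA.
  rewrite exchange_big; apply: eq_bigr => Y _; rewrite exchange_big.
  by apply: eq_bigr => Z _; rewrite mulr_sumr.
rewrite mulr_sumr; apply: ler_sum => Y _.
have psi_ge : eps * phi #|Y| <= psi #|Y|.
  by rewrite /psi lerBrDl -mulrDl sub // max_card.
have psi_ge0 : 0 <= psi #|Y| by apply: le_trans psi_ge; rewrite mulr_ge0.
rewrite (bigD1 Y) //= -[leLHS]addr0 lerD //; last first.
  by apply: sumr_ge0 => Z _; rewrite mulr_ge0 ?mulr_ge0 ?sum_charval_ge0.
under eq_bigr do rewrite charval_sqr.
have -> : \sum_(S : {set T}) 1 = 2 ^+ #|T| :> R.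
  rewrite sumr_const -natrX -[#|T|]cardsT -card_powerset; congr (_ *+ _).
  by apply: eq_card => S; rewrite inE subsetT.
rewrite mulrAC ler_wpM2r ?exprn_ge0 //.
by rewrite expr2 mulrA ler_wpM2r.
Qed.

End LinearProgrammingBound.

(** * Functions supported on a Hamming ball *)

Lemma sum_subsets_expr (R : comPzRingType) (J : finType) (x : R) :
  \sum_(Y : {set J}) x ^+ #|Y| = (1 + x) ^+ #|J|.
Proof.
rewrite -prodr_const prodr_add1_distr.
by apply: eq_bigr => Y _; rewrite prodr_const.
Qed.

(* Cauchy-Schwarz, together with the bound [(1 + x) ^+ n / x ^+ r] for the size
   of a Hamming ball of radius [r]. *)
Lemma sqr_sum_radial_le (R : realFieldType) (J : finType) (phi : nat -> R)
    (r : nat) (x : R) :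
    0 < x <= 1 -> (forall w, (r < w)%N -> phi w = 0) ->
  x ^+ r * (\sum_(Y : {set J}) phi #|Y|) ^+ 2 <=
    (1 + x) ^+ #|J| * \sum_(Y : {set J}) phi #|Y| ^+ 2.
Proof.
move=> /andP[x0 x1] phi0; pose D := [pred Y : {set J} | (#|Y| <= r)%N].
have supp (f : {set J} -> R) : (forall Y : {set J}, (r < #|Y|)%N -> f Y = 0) ->
    \sum_(Y : {set J}) f Y = \sum_(Y | D Y) f Y.
  move=> f0; rewrite (bigID D) /= [X in _ + X]big1 ?addr0 // => Y.
  by rewrite -ltnNge; apply: f0.
have -> : \sum_(Y : {set J}) phi #|Y| = \sum_(Y | D Y) phi #|Y|.
  by apply: supp => Y /phi0.
have -> : \sum_(Y : {set J}) phi #|Y| ^+ 2 = \sum_(Y | D Y) phi #|Y| ^+ 2.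
  by apply: supp => Y /phi0 ->; rewrite expr0n.
set s2 := \sum_(Y | D Y) phi #|Y| ^+ 2.
have s2_ge0 : 0 <= s2 by apply: sumr_ge0 => Y _; rewrite sqr_ge0.
have ball : x ^+ r * (\sum_(Y | D Y) 1) <= (1 + x) ^+ #|J|.
  rewrite -sum_subsets_expr mulr_sumr [leRHS](bigID D) /= -[leLHS]addr0.
  apply: lerD; last by apply: sumr_ge0 => Y _; rewrite exprn_ge0 // ltW.
  by apply: ler_sum => Y Yr; rewrite mulr1 ler_wiXn2l // ltW.
(* Cauchy-Schwarz from [u * v <= (u ^+ 2 + v ^+ 2) / 2], summed over all pairs. *)
have cs : (\sum_(Y | D Y) phi #|Y|) ^+ 2 <= (\sum_(Y | D Y) 1) * s2.
  apply: (@le_trans _ _ (\sum_(Y | D Y) \sum_(Z | D Z)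
      (phi #|Y| ^+ 2 + phi #|Z| ^+ 2) / 2)).
    rewrite expr2 mulr_suml; apply: ler_sum => Y _; rewrite mulr_sumr.
    apply: ler_sum => Z _; have := sqr_ge0 (phi #|Y| - phi #|Z|); nra.
  under eq_bigr do rewrite -mulr_suml big_split /=.
  rewrite -mulr_suml big_split /=.
  have -> : \sum_(Y | D Y) \sum_(Z | D Z) phi #|Y| ^+ 2 =
      (\sum_(Y | D Y) 1) * s2.
    rewrite exchange_big mulr_suml; apply: eq_bigr => Y _.
    by rewrite mul1r.
  have -> : \sum_(Y | D Y) \sum_(Z | D Z) phi #|Z| ^+ 2 =
      (\sum_(Y | D Y) 1) * s2.
    by rewrite mulr_suml; apply: eq_bigr => Y _; rewrite mul1r.
  lra.
apply: le_trans (ler_wpM2r s2_ge0 ball).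
by rewrite -mulrA ler_wpM2l // exprn_ge0 // ltW.
Qed.

(** * The test function on the Hamming ball *)

Section RadialProfile.
Variables (R : realFieldType) (a b beta : R).

Definition bump (w : nat) : R := Num.max 0 ((w%:R - a) * (b - w%:R)).

(** For [beta] near the square root of [w / (n - w)], the factor [beta ^+ w] makes the weights of
    the two neighbouring levels nearly equal, which reduces the hypercube operator to that of a
    path; there the parabola is almost an eigenfunction. *)
Definition profile (w : nat) : R := beta ^+ w * bump w.

Lemma bump_ge0 w : 0 <= bump w.
Proof. by rewrite /bump le_max lexx. Qed.

Lemma profile_ge0 w : 0 <= beta -> 0 <= profile w.
Proof. by move=> b0; rewrite mulr_ge0 ?exprn_ge0 ?bump_ge0. Qed.

Lemma profile_eq0 w : a <= b -> b <= w%:R -> profile w = 0.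
Proof.
move=> ab bw; rewrite /profile /bump max_l ?mulr0 // mulr_ge0_le0 //; lra.
Qed.

Lemma bumpE w : bump w = 0 \/
  (0 < bump w /\ bump w = (w%:R - a) * (b - w%:R)).
Proof.
rewrite /bump /Order.max; case: ltP => h; [by right|by left].
Qed.

(* Concavity of the parabola loses only the additive constant 2, which is
   negligible against its minimum [b - a - 1] at integer points. *)
Lemma profile_subsolution (n : nat) (lam c : R) :
    0 < beta -> 0 <= lam -> a <= b -> 1 <= a ->
    (exists i : nat, a = i%:R) -> (exists i : nat, b = i%:R) ->
    (forall w : nat, a < w%:R -> w%:R < b ->
       lam * beta <= w%:R /\ lam <= (n%:R - w%:R) * beta) ->
    c * (b - a - 1) <= lam * 2 * (b - a - 2) ->
  forall w, (w <= n)%N ->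
    c * profile w <= w%:R * profile w.-1 + (n%:R - w%:R) * profile w.+1.
Proof.
move=> beta0 lam0 ab a1 [i ai] [j bj] lamP cP w wn.
have wn' : 0 <= n%:R - w%:R :> R by rewrite subr_ge0 ler_nat.
have rhs0 : 0 <= w%:R * profile w.-1 + (n%:R - w%:R) * profile w.+1.
  by rewrite addr_ge0 // mulr_ge0 // profile_ge0 // ltW.
have [w0|[wpos wE]] := bumpE w; first by rewrite /profile w0 !mulr0.
have [aw wb] : a < w%:R /\ w%:R < b by nra.
have [l1 l2] := lamP _ aw wb.
have w_gt0 : (0 < w)%N by rewrite -(ltr_nat R); lra.
case: w w_gt0 {wn} wn' rhs0 wpos wE aw wb l1 l2 => //
  v _ wn' rhs0 wpos wE aw wb l1 l2.
rewrite /profile /=.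
have b1 : (v%:R - a) * (b - v%:R) <= bump v by rewrite /bump le_max lexx orbT.
have b2 : (v.+2%:R - a) * (b - v.+2%:R) <= bump v.+2.
  by rewrite /bump le_max lexx orbT.
(* An integer strictly between the integers [a] and [b] has distance at least 1 from both. *)
have [k0 k1] : 0 < b - a - 1 /\ b - a - 1 <= bump v.+1.
  have : (i.+1 <= v.+1)%N by rewrite -(ltr_nat R) -ai.
  have : (v.+2 <= j)%N by rewrite -(ltr_nat R) -bj.
  rewrite -!(ler_nat R) -bj -[i.+1]addn1 natrD -ai -[v.+2]addn1 natrD wE => h1 h2.
  split; nra.
have step : c * bump v.+1 <= lam * (bump v + bump v.+2).
  (* The parabola has second difference -2, and truncation at 0 can only increase the two
     neighbours. *)
  have e : 2 * bump v.+1 - 2 <= bump v + bump v.+2.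
    apply: le_trans (lerD b1 b2); rewrite wE -[v.+2]addn2 -[v.+1]addn1 !natrD; nra.
  apply: le_trans (ler_wpM2l lam0 e).
  rewrite -(ler_pM2l k0).
  apply: (@le_trans _ _ (lam * 2 * (b - a - 2) * bump v.+1)).
    by rewrite mulrA [_ * c]mulrC ler_wpM2r ?bump_ge0.
  nra.
have bv : 0 <= beta ^+ v by rewrite exprn_ge0 // ltW.
rewrite !exprS.
have s1 : lam * beta * bump v <= v.+1%:R * bump v by rewrite ler_wpM2r ?bump_ge0.
have s2 : lam * bump v.+2 <= (n%:R - v.+1%:R) * beta * bump v.+2.
  by rewrite ler_wpM2r ?bump_ge0.
have s3 : beta * (c * bump v.+1) <= beta * (lam * (bump v + bump v.+2)).
  by rewrite ler_wpM2l // ltW.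
have s4 : beta * (lam * bump v.+2) <= beta * ((n%:R - v.+1%:R) * beta * bump v.+2).
  by rewrite ler_wpM2l // ltW.
have s5 : beta * (c * bump v.+1) <=
    v.+1%:R * bump v + beta * ((n%:R - v.+1%:R) * beta * bump v.+2) by lra.
have := ler_wpM2l bv s5; lra.
Qed.

End RadialProfile.

(** * The quadratic character and point counts *)

Section QuadraticCharacter.
Variables (R : realFieldType) (F : finFieldType).

Definition is_square (c : F) : bool := [exists y, y ^+ 2 == c].

(* [chi 0 = 1], unlike the usual convention; only [c != 0] is of interest. *)
Definition chi (c : F) : R := if is_square c then 1 else -1.

Lemma finField_generator : exists z : F, forall c, c != 0 -> exists i, c = z ^+ i.
Proof.
have /cyclicP [u uE] := field_unit_group_cyclic [set: {unit F}]%G.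
exists (FinRing.uval u) => c c0.
have cU : c \is a GRing.unit by rewrite unitfE.
have : FinRing.unit F cU \in <[u]>%g by rewrite -uE inE.
by case/cycleP => i /(congr1 val) /=; rewrite FinRing.val_unitX => ->; exists i.
Qed.

(** A nonsquare is an odd power of a generator of the unit group, so two nonsquares multiply to an
    even power; the other cases follow by multiplying or dividing square roots. *)
Lemma is_squareM c d : c != 0 -> d != 0 ->
  is_square (c * d) = (is_square c == is_square d).
Proof.
have div_sq (a b : F) : a != 0 -> is_square a -> is_square (a * b) -> is_square b.
  move=> a0 /existsP[y /eqP ya] /existsP[z /eqP zb].
  apply/existsP; exists (z / y); rewrite expr_div_n ya zb mulrAC mulfV //.
  by rewrite mul1r.
have mul_sq (a b : F) : is_square a -> is_square b -> is_square (a * b).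
  move=> /existsP[y /eqP <-] /existsP[z /eqP <-].
  by apply/existsP; exists (y * z); rewrite exprMn.
move=> c0 d0; case: (boolP (is_square c)) => sc.
  case: (boolP (is_square d)) => sd; first by rewrite mul_sq.
  by apply/negbTE; apply: contraNN sd; apply: div_sq.
case: (boolP (is_square d)) => sd.
  by apply/negbTE; apply: contraNN sc; rewrite mulrC; apply: div_sq.
have [z zP] := finField_generator.
have odd_exp e : e != 0 -> ~~ is_square e -> exists2 i, odd i & e = z ^+ i.
  move=> e0; have [i ->] := zP e e0; move=> ns; exists i => //.
  apply: contraNT ns => io; apply/existsP; exists (z ^+ i./2).
  by rewrite -exprM muln2 -[in eqbRHS](odd_double_half i) (negPf io).
have [i io ->] := odd_exp c c0 sc; have [j jo ->] := odd_exp d d0 sd.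
apply/existsP; exists (z ^+ (i + j)./2).
by rewrite -exprD -exprM muln2 -[in eqbRHS](odd_double_half (i + j)) oddD io jo.
Qed.

Lemma chi_sqr c : chi c ^+ 2 = 1.
Proof. by rewrite /chi; case: ifP => _; rewrite ?sqrrN expr1n. Qed.

Lemma chiM c d : c != 0 -> d != 0 -> chi (c * d) = chi c * chi d.
Proof.
move=> c0 d0; rewrite /chi is_squareM //.
by do 2?case: is_square; rewrite ?mulrNN ?mulr1 ?mul1r.
Qed.

Lemma chi_prod (T : finType) (S : {set T}) (f : T -> F) :
  (forall a, a \in S -> f a != 0) ->
  chi (\prod_(a in S) f a) = \prod_(a in S) chi (f a).
Proof.
move=> f0; suff [] : chi (\prod_(a in S) f a) = \prod_(a in S) chi (f a) /\
    \prod_(a in S) f a != 0 by [].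
apply: (big_rec2 (fun u v => chi u = v /\ u != 0)) => [|a u v aS [<- u0]].
  rewrite oner_neq0 /chi ifT //; apply/existsP; exists 1.
  by rewrite expr1n.
by rewrite chiM ?mulf_neq0 // f0.
Qed.

Lemma card_sqrt0 : #|[set y : F | y ^+ 2 == 0]| = 1%N.
Proof.
by rewrite -[RHS](cards1 (0 : F)); apply: eq_card => y; rewrite !inE sqrf_eq0.
Qed.

Lemma card_sqrt_ge (c : F) : 2%:R != 0 :> F -> c != 0 ->
  1 + chi c <= #|[set y : F | y ^+ 2 == c]|%:R.
Proof.
move=> two c0; rewrite /chi; case: ifP => [|_]; last by rewrite subrr.
case/existsP => y /eqP yc.
have y0 : y != 0 by apply: contra_neq c0 => y0; rewrite -yc y0 expr0n.
have yN : y != - y by rewrite -subr_eq0 opprK -mulr2n -mulr_natl mulf_neq0.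
rewrite -[1 + 1]/(2%:R) ler_nat.
apply: (@leq_trans #|[set y; - y]|); first by rewrite cards2 yN.
apply/subset_leq_card/subsetP => z; rewrite !inE => /orP[] /eqP ->.
  by rewrite yc.
by rewrite sqrrN yc.
Qed.

(* The two values of [b] give [- 1] and [1] at [a = x], so that the points
   [x] of [S] contribute nothing to the character sum of [S]. *)
Definition shifted_chi (xb : F * bool) (a : F) : R :=
  if a == xb.1 then (-1) ^+ xb.2 else chi (xb.1 - a).

Lemma shifted_chi_sqr xb a : shifted_chi xb a ^+ 2 = 1.
Proof.
by rewrite /shifted_chi; case: ifP => _; rewrite ?sqrr_sign ?chi_sqr.
Qed.

Lemma charsum_shifted_chi (S : {set F}) :
  charsum shifted_chi S =
  2 * \sum_(x | x \notin S) chi (\prod_(a in S) (x - a)).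
Proof.
rewrite /charsum -(pair_bigA _ (fun x b => \prod_(a in S) shifted_chi (x, b) a)).
rewrite /= (bigID (mem S)) /= big1 ?add0r => [|x xS]; last first.
  rewrite big_bool !(big_setD1 x xS) /= /shifted_chi !eqxx /= expr1 expr0.
  under eq_bigr => a /setD1P[/negPf -> _] do [].
  under [X in _ + _ * X]eq_bigr => a /setD1P[/negPf -> _] do [].
  by rewrite mulN1r mul1r addNr.
rewrite mulr_sumr; apply: eq_bigr => x xS.
have E b : \prod_(a in S) shifted_chi (x, b) a = chi (\prod_(a in S) (x - a)).
  rewrite chi_prod => [|a aS].
    apply: eq_bigr => a aS; rewrite /shifted_chi ifF //=.
    by apply/negbTE; apply: contraNneq xS => <-.
  by rewrite subr_eq0; apply: contraNneq xS => ->.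
by rewrite big_bool !E mulr_natl mulr2n.
Qed.

End QuadraticCharacter.

(** The fibre over [x] in [S] is the single point [y = 0], any other fibre has at least [1 + chi]
    points, and the points at infinity are dropped. *)
Lemma XS_points_ge (R : realFieldType) (p : nat) (S : {set 'F_p}) :
    prime p -> (2 < p)%N ->
  p%:R + charsum (@shifted_chi R 'F_p) S / 2 <= (XS_points S)%:R.
Proof.
move=> pp p2; have two : 2%:R != 0 :> 'F_p.
  rewrite -(dvdn_pcharf (pchar_Fp pp)); apply/negP => /dvdn_leq; lia.
have -> : p%:R + charsum (@shifted_chi R 'F_p) S / 2 =
    \sum_(x : 'F_p) (1 + if x \in S then 0 else chi R (fS S).[x]).
  rewrite big_split /= sumr_const card_Fp //; congr (_ + _).
  rewrite charsum_shifted_chi mulrAC mulfV ?pnatr_eq0 // mul1r.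
  rewrite [RHS](bigID (mem S)) /= [X in _ = X + _]big1 ?add0r => [|x ->//].
  apply: eq_bigr => x /negPf ->; congr chi.
  by rewrite /fS horner_prod; apply: eq_bigr => a _; rewrite hornerXsubC.
have card_aff : #|affine_points S| =
    (\sum_(x : 'F_p) #|[set y : 'F_p | y ^+ 2 == (fS S).[x]]|)%N.
  transitivity (\sum_(x : 'F_p) \sum_(y : 'F_p)
      if (x, y) \in affine_points S then 1 else 0)%N.
    by rewrite pair_bigA /= -sum1_card big_mkcond; apply: eq_bigr => -[].
  apply: eq_bigr => x _; rewrite -big_mkcond -sum1_card.
  by apply: eq_bigl => y; rewrite !inE.
rewrite /XS_points natrD card_aff natr_sum -[leLHS]addr0 lerD //.
have fSE x : (fS S).[x] = \prod_(a in S) (x - a).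
  by rewrite /fS horner_prod; apply: eq_bigr => a _; rewrite hornerXsubC.
apply: ler_sum => x _; rewrite fSE; case: ifPn => xS.
  by rewrite (big_setD1 x xS) /= subrr mul0r card_sqrt0 addr0.
apply: card_sqrt_ge => //; apply/prodf_neq0 => a aS.
by rewrite subr_eq0; apply: contraNneq xS => ->.
Qed.

(** * Numerical estimates and choice of parameters *)

Lemma ler_bernoulli (R : realFieldType) (h : R) (k : nat) :
  0 <= h -> 1 + h *+ k <= (1 + h) ^+ k.
Proof.
move=> h0; elim: k => [|k IH]; first by rewrite mulr0n addr0 expr0.
rewrite exprS mulrSr; have hk : 0 <= h *+ k by rewrite mulrn_wge0.
by nra.
Qed.

Lemma exists_card (J : finType) (m : nat) :
  (m <= #|J|)%N -> exists Y : {set J}, #|Y| = m.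
Proof.
move=> mJ; have : (0 < #|[set Y : {set J} | #|Y| == m]|)%N.
  by rewrite card_draws bin_gt0.
by case/card_gt0P => Y; rewrite inE => /eqP; exists Y.
Qed.

(* [(9/8) ^ 23 < 2 ^ 4]: with [n = 2 p] and radius [5 p / 23], the ball bound
   [8 ^ r (9/8) ^ n] is exponentially smaller than [2 ^ p]. *)
Lemma ball_bound_lt (R : realFieldType) (k s : nat) :
    (s < 23)%N -> 100 ^+ 4 <= k%:R :> R ->
  3496 * ((9 / 8) ^+ (2 * (23 * k + s)) * 8 ^+ (5 * k)) < 2 ^+ (23 * k + s) :> R.
Proof.
move=> s23 k_ge.
have q226 : (9 / 8 : R) ^+ 46 <= 226.
  rewrite expr_div_n ler_pdivrMr ?exprn_gt0 //; lra.
(* Here 256 is [2 ^ 23 / 8 ^ 5], the growth per unit of [k] to be compared with 226; the extra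
   constant factor 256 absorbs the remainder [s], which costs at most 226. *)
have grow : 3496 * 256 * 226 ^+ k < (256 : R) ^+ k.
  have -> : 256 = 226 * (1 + 30 / 226) :> R by lra.
  rewrite exprMn mulrC ltr_pM2l ?exprn_gt0 //.
  apply: lt_le_trans (ler_bernoulli k _); last by lra.
  rewrite -mulr_natr; lra.
have e1 : (9 / 8 : R) ^+ (2 * s) <= 226.
  by apply: le_trans q226; rewrite ler_weXn2l //; [lra | lia].
have e2 : ((9 / 8 : R) ^+ 46) ^+ k <= 226 ^+ k.
  by rewrite lerXn2r // nnegrE ?exprn_ge0 ?divr_ge0.
rewrite mulnDr exprD mulnA exprM [(9 / 8) ^+ (2 * 23)](_ : _ = (9 / 8) ^+ 46) //.
rewrite [8 ^+ _]exprM [2 ^+ _]exprD [2 ^+ (23 * k)]exprM.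
have -> : 2 ^+ 23 = 256 * 8 ^+ 5 :> R by lra.
rewrite [(256 * _) ^+ _]exprMn.
set u := _ ^+ k in e2 *; set v := (8 ^+ 5) ^+ k.
have v0 : 0 < v by rewrite /v !exprn_gt0 ?ltr0n.
have u0 : 0 <= u by rewrite /u !exprn_ge0 ?divr_ge0.
apply: (@lt_le_trans _ _ (256 ^+ k * v)); last first.
  by rewrite ler_peMr ?exprn_ege1 ?ler1n // mulr_ge0 ?exprn_ge0 // ltW.
rewrite !mulrA ltr_pM2r //; apply: le_lt_trans grow.
have := ler_pM u0 (exprn_ge0 _ _) e2 e1; lra.
Qed.

Lemma exists_large_charsum (R : realFieldType) (T J : finType) (g : J -> T -> R)
    (k s : nat) :
    (forall j a, g j a ^+ 2 = 1) -> #|J| = (2 * #|T|)%N ->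
    #|T| = (23 * k + s)%N -> (s < 23)%N -> 100 ^+ 4 <= k%:R :> R ->
  exists2 S : {set T}, S != set0 & 62 / 100 * #|J|%:R < charsum g S.
Proof.
move=> g_sqr cardJ cardT s23 k_ge.
suff /existsP[S /andP[S0 S_gt]] :
    [exists S : {set T}, (S != set0) && (62 / 100 * #|J|%:R < charsum g S)].
  by exists S.
apply: contraT => /existsPn small.
pose K : R := k%:R; pose n : R := #|J|%:R.
have K_ge : 100 ^+ 4 <= K by [].
have nE : n = 46 * K + 2 * s%:R.
  by rewrite /n cardJ cardT natrM natrD natrM -/K; lra.
have nK : 46 * K <= n <= 46 * K + 44.
  have := ler0n R s; have : s%:R <= 22 :> R by rewrite (ler_nat R s 22).
  by rewrite nE; lra.
have k_ge3 : (1000 <= k)%N by rewrite -(ler_nat R) -/K; clear -K_ge; lra.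
have k5_le : (5 * k <= #|J|)%N by rewrite cardJ cardT; lia.
pose mu : R := 62 / 100 * n; pose eps : R := K / 100.
(* The support is the levels strictly between [a] and [b], up to [5 * k]. With [b - a = 1001],
   concavity costs only the factor 999/1000. *)
pose a : R := (5 * k - 1000)%:R; pose b : R := (5 * k).+1%:R.
have aE : a = 5 * K - 1000 by rewrite /a natrB ?natrM //; lia.
have bE : b = 5 * K + 1 by rewrite /b -addn1 natrD natrM.
(* 349/1000 approximates the square root of 5/41, for levels near [5 * K] in dimension about
   [46 * K]. *)
pose phi := profile a b (349 / 1000).
have beta0 : 0 < 349 / 1000 :> R by rewrite divr_gt0.
have phi_sub w : (w <= #|J|)%N ->
    (mu + eps) * phi w <= w%:R * phi w.-1 + (#|J|%:R - w%:R) * phi w.+1.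
  (* 2859/200 = 14.295 is just below the square root of 5 * 41; doubled, it is 28.59, which exceeds
     0.62 * 46 + 0.01 = 28.53 with room for the factor 999/1000. *)
  apply: (@profile_subsolution _ _ _ _ _ (2859 / 200 * K)) => //.
  - by rewrite mulr_ge0 ?divr_ge0 ?ler0n.
  - by rewrite aE bE; clear; lra.
  - by rewrite aE; clear -K_ge; lra.
  - by exists (5 * k - 1000)%N.
  - by exists (5 * k).+1.
  - by move=> v; rewrite aE bE -/n; clear -K_ge nK => va vb; split; lra.
  - by rewrite /mu /eps aE bE; clear -K_ge nK; lra.
have sum_le (S : {set T}) : S != set0 -> charsum g S <= mu.
  by move=> S0; have := small S; rewrite S0 /= -leNgt.
have phi_ge0 w : 0 <= phi w by apply/profile_ge0/ltW.
have eps_ge0 : 0 <= eps by rewrite divr_ge0.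
have := linear_programming_bound g_sqr eps_ge0 phi_ge0 phi_sub sum_le.
have phi_eq0 w : (5 * k < w)%N -> phi w = 0.
  move=> kw; apply: profile_eq0; last by rewrite /b ler_nat.
  by rewrite aE bE; clear; lra.
(* 1/8 is close to 5/41, the minimiser of the ball bound at this radius. *)
have x01 : 0 < (8^-1 : R) <= 1 by clear; lra.
have := sqr_sum_radial_le J x01 phi_eq0.
set s1 := \sum_(Y : {set J}) phi #|Y|.
set s2 := \sum_(Y : {set J}) phi #|Y| ^+ 2.
(* The level [5 * k] lies in the support: the parabola equals 1000 there. *)
have s2_gt0 : 0 < s2.
  have [Y Yk] := exists_card k5_le.
  rewrite /s2 (bigD1 Y) //= ltr_wpDr ?sumr_ge0 // => [Z _|]; first exact: sqr_ge0.
  rewrite Yk exprn_gt0 // mulr_gt0 ?exprn_gt0 //.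
  by rewrite lt_max aE bE natrM -/K; apply/orP; right; clear; nra.
have -> : 1 + 8^-1 = 9 / 8 :> R by clear; lra.
have := ball_bound_lt s23 k_ge; rewrite -cardT -cardJ exprVn.
set N := (9 / 8) ^+ _; set v := 8 ^+ _; set P := 2 ^+ _ => ball s1_le lp.
have v_gt0 : 0 < v by rewrite exprn_gt0.
have N_gt0 : 0 < N by rewrite exprn_gt0 // divr_gt0.
have s1_le' : s1 ^+ 2 <= v * N * s2 by rewrite -mulrA -ler_pdivrMl.
have K_gt0 : 0 < K by clear -K_ge; lra.
(* 3496/100 is 0.38 * 92, from [n <= 92 * K]; dividing by [eps = K / 100] gives the constant 3496 of
   the ball bound. *)
have n_le : #|J|%:R - mu <= 3496 / 100 * K.
  by rewrite -/n /mu; clear -K_ge nK; lra.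
have n_ge0 : 0 <= #|J|%:R - mu by rewrite -/n /mu; clear -K_ge nK; lra.
have h : K / 100 * P * s2 <= 3496 / 100 * K * (v * N * s2).
  by apply: le_trans lp _; apply: ler_pM => //; exact: sqr_ge0.
have : (K / 100 * s2) * P <= (K / 100 * s2) * (3496 * (N * v)).
  by clear -h; lra.
by rewrite ler_pM2l ?mulr_gt0 ?invr_gt0 // leNgt ball.
Qed.

Theorem theorem3 (R : realType) :
  exists p0 : nat, forall p : nat,
    prime p -> (p0 < p)%N -> p = 1 %[mod 4] -> ~ B (162%:R / 100%:R : R) p.
Proof.
have [M M_ge] : exists M : nat, 100 ^+ 4 <= M%:R :> R.
  by exists (Num.bound (100 ^+ 4 : R)); rewrite ltW // archi_boundP ?exprn_ge0.
exists (M * 23)%N => p p_prime p_gt _ Bp.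
have p_gt2 : (2 < p)%N.
  apply: leq_trans p_gt; case: (posnP M) M_ge => [-> | M_gt0 _]; last by lia.
  by rewrite leNgt exprn_gt0.
have k_ge : 100 ^+ 4 <= (p %/ 23)%:R :> R.
  by apply: le_trans M_ge _; rewrite ler_nat leq_divRL // ltnW.
have cardJ : #|{: 'F_p * bool}| = (2 * #|'F_p|)%N.
  by rewrite card_prod card_bool mulnC.
have cardT : #|'F_p| = (23 * (p %/ 23) + p %% 23)%N.
  by rewrite card_Fp // mulnC; exact: divn_eq.
have [S S0] := exists_large_charsum (@shifted_chi_sqr R 'F_p) cardJ cardT
  (@ltn_pmod p 23 isT) k_ge.
(* A character sum above 0.62 * 2p gives more than p + 0.62 p points. *)
have := XS_points_ge R S p_prime p_gt2; have := Bp S S0.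
by rewrite cardJ card_Fp // natrM; clear; lra.
Qed.
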